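(* Let $G$ be an abelian profinite group. Then for every commutative ring $R$ with identity, the map $$\varphi_R:\mathbf{Ap}_G(R)\to R^{\mathcal O(G)},\qquad \varphi_R(\mathbf x)(U)=\sum_{U\leqslant V\leqslant G}x_V,$$ is a ring isomorphism.
   Context: $\mathcal O(G)$ is the set of open subgroups of $G$, and $R^{\mathcal O(G)}$ is the ring of all maps $\mathcal O(G)\to R$ with pointwise operations. For $G$ abelian, $\mathbf{Ap}_G(R)$ is the set $\prod_{U\in\mathcal O(G)}R$ with componentwise addition and multiplication $$(\mathbf x\mathbf y)_U=\sum_{V,W\in\mathcal O(G),\ V\cap W=U}x_Vy_W .$$ *)

(* Defs.v *)
From HB Require Import structures.
From mathcomp Require Import all_boot all_order all_algebra finmap.
From mathcomp Require Import all_classical all_reals all_analysis.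

Set Implicit Arguments.
Unset Strict Implicit.
Unset Printing Implicit Defensive.

Import Order.TTheory GRing.Theory.
Local Open Scope classical_set_scope.
Local Open Scope ring_scope.

(* Abelian profinite groups, written additively: compact, Hausdorff, totally
   disconnected topological abelian groups. *)
HB.mixin Record TopologicalZmodule_isProfinite G & TopologicalZmodule G := {
  profinite_compact : compact [set: G];
  profinite_hausdorff : hausdorff_space G;
  profinite_totally_disconnected : totally_disconnected [set: G]
}.

#[short(type="profiniteZmodType")]
HB.structure Definition ProfiniteZmodule :=
  {G of TopologicalZmodule G & TopologicalZmodule_isProfinite G}.

Record open_subgroup (G : topologicalZmodType) := OpenSubgroup {
  osub_set :> set G;
  osub_open : open osub_set;
  osub0 : osub_set 0;
  osubB : forall x y, osub_set x -> osub_set y -> osub_set (x - y)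
}.

HB.instance Definition _ G := gen_eqMixin (open_subgroup G).
HB.instance Definition _ G := gen_choiceMixin (open_subgroup G).

Section OpenSubgroups.
Variable G : topologicalZmodType.
Implicit Types U V W : open_subgroup G.

Lemma osub_inj U V : osub_set U = osub_set V -> U = V.
Proof.
case: U V => [A ? ? ?] [B ? ? ?] /= AB; subst B.
by congr OpenSubgroup; exact: Prop_irrelevance.
Qed.

Definition osubT : open_subgroup G :=
  @OpenSubgroup G setT openT I (fun _ _ _ _ => I).

Lemma osubI_subproof V W (x y : G) :
  (V `&` W) x -> (V `&` W) y -> (V `&` W) (x - y).
Proof. by move=> [? ?] [? ?]; split; exact: osubB. Qed.

Definition osubI V W : open_subgroup G :=
  OpenSubgroup (openI (osub_open V) (osub_open W))
    (conj (osub0 V) (osub0 W)) (@osubI_subproof V W).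

Lemma osubIA : associative osubI.
Proof. by move=> U V W; apply: osub_inj; rewrite /= setIA. Qed.

Lemma osubIC : commutative osubI.
Proof. by move=> U V; apply: osub_inj; rewrite /= setIC. Qed.

Lemma osubTI : left_id osubT osubI.
Proof. by move=> U; apply: osub_inj; rewrite /= setTI. Qed.

Lemma osubN U x : osub_set U x -> osub_set U (- x).
Proof. by move=> Ux; rewrite -sub0r; apply: osubB => //; exact: osub0. Qed.

Lemma osubD U x y :
  osub_set U x -> osub_set U y -> osub_set U (x + y).
Proof. by move=> Ux Uy; rewrite -[y]opprK; apply: osubB => //; exact: osubN. Qed.

End OpenSubgroups.

Lemma finite_overgroups (G : profiniteZmodType) (U : open_subgroup G) :
  finite_set [set V : open_subgroup G | U `<=` V].
Proof.
pose coset (d : G) : set G := [set x | osub_set U (x - d)].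
have open_coset d : setT d -> open (coset d).
  move=> _; apply: (@open_comp _ _ (fun x : G => x - d)); last exact: osub_open.
  move=> x _; apply: (@continuous_comp _ _ _ (fun x : G => (x, d))
    (fun z : G * G => z.1 - z.2)); last exact: sub_continuous.
  by apply: cvg_pair => /=; [exact: cvg_id|exact: cvg_cst].
have : cover_compact [set: G].
  pose p0 := isPointed.Build (ProfiniteZmodule.sort G) 0.
  pose pG : ptopologicalType := HB.pack (ProfiniteZmodule.sort G) p0.
  by rewrite -(@compact_cover pG); exact: profinite_compact.
move=> /(_ _ setT coset open_coset)[].
  by move=> x _; exists x => //; rewrite /coset/= subrr; exact: osub0.
move=> D _ Dcover.
pose trace (V : open_subgroup G) : {fset G} := [fset d in D | `[< osub_set V d >]]%fset.
have trace_inj : {in [set V : open_subgroup G | U `<=` V] &, injective trace}.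
  have sub (V W : open_subgroup G) : U `<=` V -> U `<=` W ->
      trace V = trace W -> V `<=` W.
    move=> UV UW VW x Vx; have [d /= dD xd] := Dcover x I.
    have : d \in trace V.
      rewrite !inE dD /=; apply/asboolP.
      by rewrite -[d](subKr x); apply: osubB => //; exact: UV.
    rewrite VW !inE => /andP[_ /asboolP Wd].
    by rewrite -(subrK d x); apply: osubD => //; exact: UW.
  move=> V W; rewrite !inE/= => UV UW VW.
  by apply: osub_inj; apply/seteqP; split; apply: sub.
rewrite -(eq_finite_set (inj_card_eq trace_inj)).
apply: (finite_subfset (fpowerset D)) => _ [V UV <-] /=.
by rewrite fpowersetE; apply/fsubsetP => d; rewrite !inE => /andP[].
Qed.

(* The underlying set of Ap_G(R); a named alias, because the function type
   already carries the pointwise product. *)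
Definition ap (G : topologicalZmodType) (R : Type) : Type := open_subgroup G -> R.

#[warnings="-redundant-canonical-projection"]
HB.instance Definition _ (G : topologicalZmodType) (R : zmodType) :=
  GRing.Zmodule.copy (ap G R) (open_subgroup G -> R).

Section ApRing.
Variables (G : profiniteZmodType) (R : comPzRingType).
Implicit Types (x y z : ap G R) (U V W : open_subgroup G).

Definition ap_one : ap G R := fun U => (U == osubT G)%:R.

(* The family is finite, since V and W contain U (finite_overgroups); a finitely
   supported sum over an infinite set would silently default to 0. *)
Definition ap_mul x y : ap G R := fun U =>
  \sum_(VW \in [set VW : open_subgroup G * open_subgroup G |
                 osubI VW.1 VW.2 = U]) x VW.1 * y VW.2.

Let overs U := fset_set [set V : open_subgroup G | U `<=` V].

Let overs_mem U V : (V \in overs U) = `[< U `<=` V >].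
Proof.
rewrite in_fset_set; last exact: finite_overgroups.
by apply/idP/asboolP; rewrite inE.
Qed.

Let osubI_overs U V W : V \in overs U -> W \in overs U -> osubI V W \in overs U.
Proof.
rewrite !overs_mem => /asboolP UV /asboolP UW; apply/asboolP => t Ut.
by split; [exact: UV|exact: UW].
Qed.

Let ap_mulE U x y (A : open_subgroup G) : U `<=` A ->
  ap_mul x y A = \sum_(V <- overs U) \sum_(W <- overs U)
     if osubI V W == A then x V * y W else 0.
Proof.
move=> UA; rewrite /ap_mul.
pose r := [seq (V, W) | V <- overs U, W <- overs U].
have r_uniq : uniq r.
  by rewrite allpairs_uniq ?fset_uniq// => -[? ?] [? ?] _ _ [-> ->].
pose P (VW : open_subgroup G * open_subgroup G) := osubI VW.1 VW.2 == A.
rewrite (_ : mkset _ = [set` P]); last first.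
  by apply/seteqP; split=> VW /eqP.
rewrite -(bigfs _ r_uniq); last first.
  move=> [V W] /eqP/= VWA; apply: contraNeq => _.
  apply/allpairsP; exists (V, W); split=> //=; rewrite overs_mem;
    by apply/asboolP => t /UA; rewrite -VWA => -[].
by rewrite big_mkcond big_allpairs.
Qed.

Let sum_overs_eq U C (f : open_subgroup G -> R) : C \in overs U ->
  \sum_(A <- overs U) (if C == A then f A else 0) = f C.
Proof.
move=> CU; rewrite (bigD1_seq C)//= ?fset_uniq// eqxx big1 ?addr0// => A.
by rewrite eq_sym => /negbTE ->.
Qed.

Let overs_refl U : U `<=` U. Proof. by []. Qed.

Let ap_mul3E x y z U : ap_mul x (ap_mul y z) U =
  \sum_(V <- overs U) \sum_(W <- overs U) \sum_(Z <- overs U)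
     if osubI V (osubI W Z) == U then x V * (y W * z Z) else 0.
Proof.
rewrite (ap_mulE _ _ (@overs_refl U)); apply: eq_bigr => V _.
transitivity (\sum_(A <- overs U) \sum_(W <- overs U) \sum_(Z <- overs U)
    if osubI W Z == A then
      if osubI V A == U then x V * (y W * z Z) else 0 else 0).
  apply: eq_big_seq => A; rewrite overs_mem => /asboolP UA.
  rewrite (ap_mulE _ _ UA) (fun_if (fun t => t)); case: ifP => _; last first.
    by rewrite big1// => W _; rewrite big1// => Z _; rewrite if_same.
  rewrite mulr_sumr; apply: eq_bigr => W _.
  by rewrite mulr_sumr; apply: eq_bigr => Z _; rewrite (fun_if ( *%R _)) mulr0.
rewrite exchange_big; apply: eq_big_seq => W WU.
rewrite exchange_big; apply: eq_big_seq => Z ZU.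
by rewrite sum_overs_eq//; exact: osubI_overs.
Qed.

Let ap_mulC : commutative ap_mul.
Proof.
move=> x y; apply/funext => U; rewrite !(ap_mulE _ _ (@overs_refl U)).
rewrite exchange_big; apply: eq_bigr => V _; apply: eq_bigr => W _.
by rewrite (osubIC W) [y _ * _]mulrC.
Qed.

Let ap_mulA : associative ap_mul.
Proof.
move=> x y z; rewrite [RHS]ap_mulC; apply/funext => U; rewrite !ap_mul3E.
rewrite [RHS]exchange_big; apply: eq_bigr => V _.
rewrite [RHS]exchange_big; apply: eq_bigr => W _; apply: eq_bigr => Z _.
by rewrite osubIA (osubIC Z) mulrA (mulrC (z Z)).
Qed.

Let ap_mul1 : left_id ap_one ap_mul.
Proof.
move=> x; apply/funext => U; rewrite (ap_mulE _ _ (@overs_refl U)) exchange_big.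
transitivity (\sum_(W <- overs U) if U == W then x W else 0); last first.
  by rewrite sum_overs_eq// overs_mem; apply/asboolP.
apply: eq_bigr => W _.
have TU : osubT G \in overs U by rewrite overs_mem; apply/asboolP.
rewrite -[RHS](sum_overs_eq (fun=> _) TU); apply: eq_bigr => V _.
rewrite /ap_one (eq_sym (osubT G)); case: (V =P osubT G) => [->|_].
  by rewrite osubTI mul1r eq_sym.
by rewrite mul0r if_same.
Qed.

Let ap_mulDl : left_distributive ap_mul +%R.
Proof.
move=> x y z; apply/funext => U.
rewrite [RHS](_ : _ = ap_mul x z U + ap_mul y z U)//.
rewrite !(ap_mulE _ _ (@overs_refl U)).
rewrite -big_split; apply: eq_bigr => V _; rewrite -big_split.
apply: eq_bigr => W _; case: ifP => _ /=; last by rewrite addr0.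
exact: mulrDl.
Qed.

HB.instance Definition _ := GRing.Zmodule_isComPzRing.Build (ap G R)
  ap_mulA ap_mulC ap_mul1 ap_mulDl.

End ApRing.

Definition ap_phi (G : profiniteZmodType) (R : comPzRingType) (x : ap G R) :
    open_subgroup G -> R :=
  fun U => \sum_(V \in [set V : open_subgroup G | U `<=` V]) x V.

(* Main.v *)
(** Each open subgroup has only finitely many overgroups, so [ap_phi] is
    summation over the finite up-sets of the poset of open subgroups, and it can
    be inverted by recursion on the number of overgroups.  It is multiplicative
    because a pair of open subgroups [V], [W] both contain [U] exactly when
    [V `&` W] does. *)
Require Import Defs.
From HB Require Import structures.
From mathcomp Require Import all_boot all_order all_algebra finmap.
From mathcomp Require Import all_classical all_reals all_analysis.

Set Implicit Arguments.
Unset Strict Implicit.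
Unset Printing Implicit Defensive.

Import GRing.Theory.
Local Open Scope ring_scope.

Definition overgroups (G : profiniteZmodType) (U : open_subgroup G) :
    {fset open_subgroup G} :=
  fset_set [set V : open_subgroup G | (U `<=` V)%classic]%classic.

Lemma overgroupsP (G : profiniteZmodType) (U V : open_subgroup G) :
  reflect (U `<=` V)%classic (V \in overgroups U).
Proof.
(* [fset_set] is empty on an infinite set, so membership is faithful only because [U] has finitely
   many overgroups. *)
rewrite in_fset_set; last exact: finite_overgroups.
by apply: (iffP idP); rewrite inE.
Qed.

Lemma overgroups_refl (G : profiniteZmodType) (U : open_subgroup G) :
  U \in overgroups U.
Proof. by apply/overgroupsP. Qed.

Lemma overgroupsI (G : profiniteZmodType) (U V W : open_subgroup G) :
  (osubI V W \in overgroups U) = (V \in overgroups U) && (W \in overgroups U).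
Proof.
apply/overgroupsP/andP => [|[/overgroupsP UV /overgroupsP UW]].
  by rewrite /= subsetI => -[UV UW]; split; apply/overgroupsP.
by rewrite /= subsetI.
Qed.

(** Passing to a strictly larger [V] loses [U] itself as an overgroup. This is the measure that
    makes the inversion of [ap_phi] terminate. *)
Lemma overgroups_card_lt (G : profiniteZmodType) (U V : open_subgroup G) :
  V \in overgroups U -> V != U -> (#|` overgroups V| < #|` overgroups U|)%N.
Proof.
move=> /overgroupsP UV neqVU; apply: fproper_ltn_card.
rewrite fproperEneq; apply/andP; split.
  apply: contraNneq neqVU => eqVU; apply/eqP/osub_inj/seteqP; split=> //.
  by apply/overgroupsP; rewrite eqVU; exact: overgroups_refl.
apply/fsubsetP => W /overgroupsP VW.
by apply/overgroupsP; exact: subset_trans VW.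
Qed.

Lemma ap_phiE (G : profiniteZmodType) (R : comPzRingType) (x : ap G R)
  (U : open_subgroup G) : ap_phi x U = \sum_(V <- overgroups U) x V.
Proof. by rewrite /ap_phi fsbig_finite//; exact: finite_overgroups. Qed.

(** One list of pairs serves every [A] above [U]: if [V] and [W] meet in [A], both contain [U].
    Having the list independent of [A] allows the exchange of sums in [ap_phi_mul]. *)
Lemma ap_mulE (G : profiniteZmodType) (R : comPzRingType) (x y : ap G R)
    (U A : open_subgroup G) : A \in overgroups U ->
  ap_mul x y A =
  \sum_(p <- [seq (V, W) | V <- overgroups U, W <- overgroups U]
       | osubI p.1 p.2 == A) x p.1 * y p.2.
Proof.
move=> UA; rewrite bigfs.
- by apply: eq_fsbigl; apply/seteqP; split=> p /eqP.
- by rewrite allpairs_uniq ?fset_uniq// => -[? ?] [? ?] _ _ [-> ->].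
- move=> [V W] /eqP/= VWA; apply: contraNeq => _.
  by apply: allpairs_f; move: UA; rewrite -VWA overgroupsI => /andP[].
Qed.

Lemma ap_phi_mul (G : profiniteZmodType) (R : comPzRingType) (x y : ap G R)
  (U : open_subgroup G) : ap_phi (ap_mul x y) U = ap_phi x U * ap_phi y U.
Proof.
rewrite !ap_phiE (eq_big_seq _ (fun A => ap_mulE x y (U := U) (A := A))).
rewrite (exchange_big_dep xpredT)//= big_distrlr/= big_allpairs.
apply: eq_big_seq => V UV; apply: eq_big_seq => W UW /=.
(* Each pair is counted for exactly one [A], its intersection, which is again an overgroup of
   [U]. *)
rewrite (eq_bigl (pred1 (osubI V W))) => [|A]; last by rewrite /= eq_sym.
by rewrite -big_filter filter_pred1_uniq ?fset_uniq ?overgroupsI ?UV// big_seq1.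
Qed.

Lemma ap_phi_one (G : profiniteZmodType) (R : comPzRingType)
  (U : open_subgroup G) : ap_phi (@ap_one G R) U = 1.
Proof.
have UT : osubT G \in overgroups U by apply/overgroupsP.
rewrite ap_phiE (bigD1_seq (osubT G)) ?fset_uniq//= /ap_one eqxx.
rewrite big1 ?addr0// => V.
by move=> /negbTE ->.
Qed.

Lemma ap_phiD1 (G : profiniteZmodType) (R : comPzRingType) (x : ap G R)
  (U : open_subgroup G) :
  ap_phi x U = x U + \sum_(V <- overgroups U | V != U) x V.
Proof. by rewrite ap_phiE (bigD1_seq U) ?overgroups_refl ?fset_uniq. Qed.

(* [n] is fuel: the value at [U] is the intended one as soon as [n] is at least
   the number of overgroups of [U]. *)
Fixpoint moebius_rec (G : profiniteZmodType) (R : comPzRingType)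
    (f : open_subgroup G -> R) (n : nat) (U : open_subgroup G) : R :=
  if n is m.+1 then
    f U - \sum_(V <- overgroups U | V != U) moebius_rec f m V
  else 0.

Definition moebius (G : profiniteZmodType) (R : comPzRingType)
    (f : open_subgroup G -> R) : ap G R :=
  fun U => moebius_rec f #|` overgroups U| U.

Lemma overgroups_card_gt0 (G : profiniteZmodType) (U : open_subgroup G) :
  (0 < #|` overgroups U|)%N.
Proof. by rewrite cardfs_gt0; apply/fset0Pn; exists U; exact: overgroups_refl. Qed.

(** Recursive calls go to subgroups with strictly fewer overgroups, so one unit less of fuel still
    suffices there. Fuel 0 is excluded since [U] is its own overgroup. *)
Lemma moebius_rec_stable (G : profiniteZmodType) (R : comPzRingType)
    (f : open_subgroup G -> R) (n m : nat) (U : open_subgroup G) :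
  (#|` overgroups U| <= n)%N -> (#|` overgroups U| <= m)%N ->
  moebius_rec f n U = moebius_rec f m U.
Proof.
elim: n m U => [|n IHn] [|m] U; try by rewrite [(_ <= 0)%N]leqNgt overgroups_card_gt0.
move=> Un Um /=; congr (_ - _).
rewrite big_seq_cond [RHS]big_seq_cond.
apply: eq_bigr => V /andP[UV VU].
by apply: IHn; rewrite -ltnS; apply: leq_trans (overgroups_card_lt UV VU) _.
Qed.

Lemma moebiusK (G : profiniteZmodType) (R : comPzRingType) :
  cancel (@moebius G R) (@ap_phi G R).
Proof.
move=> f; apply/funext => U; rewrite ap_phiD1.
suff -> : moebius f U = f U - \sum_(V <- overgroups U | V != U) moebius f V.
  by rewrite subrK.
rewrite {1}/moebius; have := overgroups_card_gt0 U.
case eqn: #|` _| => [//|n] _ /=; congr (_ - _).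
rewrite big_seq_cond [RHS]big_seq_cond; apply: eq_bigr => V /andP[UV VU].
(* The recursive call has the fuel [n] left over from [U], while [moebius f V] starts from the
   number of overgroups of [V]; both are enough. *)
apply: moebius_rec_stable => //.
by rewrite -ltnS -eqn; exact: overgroups_card_lt.
Qed.

(** By induction on the fuel, the subtracted terms are the values of [x] strictly above [U], which
    leaves the diagonal term of [ap_phiD1]. *)
Lemma moebius_rec_ap_phi (G : profiniteZmodType) (R : comPzRingType)
    (x : ap G R) (n : nat) (U : open_subgroup G) :
  (#|` overgroups U| <= n)%N -> moebius_rec (ap_phi x) n U = x U.
Proof.
elim: n U => [|n IHn] U; first by rewrite leqNgt overgroups_card_gt0.
move=> Un /=; rewrite ap_phiD1; apply/eqP; rewrite subr_eq; apply/eqP.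
congr (_ + _); rewrite big_seq_cond [RHS]big_seq_cond.
apply: eq_bigr => V /andP[UV VU]; rewrite IHn// -ltnS.
exact: leq_trans (overgroups_card_lt UV VU) _.
Qed.

Lemma ap_phiK (G : profiniteZmodType) (R : comPzRingType) :
  cancel (@ap_phi G R) (@moebius G R).
Proof. by move=> x; apply/funext => U; exact: moebius_rec_ap_phi. Qed.

Theorem corollary4p3 (G : profiniteZmodType) (R : comPzRingType) :
  [/\ zmod_morphism (@ap_phi G R : ap G R -> (open_subgroup G -> R)),
      monoid_morphism (@ap_phi G R : ap G R -> (open_subgroup G -> R))
    & bijective (@ap_phi G R)].
Proof.
split; last by exists (@moebius G R); [exact: ap_phiK|exact: moebiusK].
- move=> x y; apply/funext => U.
  by rewrite [RHS](_ : _ = ap_phi x U - ap_phi y U)// !ap_phiE -sumrB.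
- split; first by apply/funext => U; exact: ap_phi_one.
  by move=> x y; apply/funext => U; exact: ap_phi_mul.
Qed.
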